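(* Let $m\ge0$ be an integer and let $\alpha>m-1$ be real. As $n\to\infty$, the exceptional zeros of the type II exceptional Laguerre polynomial $L^{\mathrm{II}(\alpha)}_{m,n}$, $n\ge m$, converge to the zeros of $\eta_{\alpha+1,m}(z)=L^{(-\alpha-1)}_m(z)$; that is, if $w_1,\dots,w_m$ are the zeros of $L^{(-\alpha-1)}_m$ in $\mathbb{C}$ listed with multiplicity, then for each $n\ge m$ the exceptional zeros of $L^{\mathrm{II}(\alpha)}_{m,n}$ can be labelled $w_{n,1},\dots,w_{n,m}$ so that $\lim_{n\to\infty}w_{n,i}=w_i$ for $i=1,\dots,m$.
   Context: For real $\alpha$ and integer $n\ge 0$, $L^{(\alpha)}_n(z)=\sum_{k=0}^n \binom{n+\alpha}{n-k}\frac{(-z)^k}{k!}$ is the classical Laguerre polynomial (generalized binomial coefficients), and $L^{(\alpha)}_{-1}:=0$. Put $\eta_{\alpha,m}(z)=L^{(-\alpha)}_m(z)$ and $A^{\mathrm{II}}_{\alpha,m}[y]=z\,\eta_{\alpha,m}\,y'+(\alpha-m)\,\eta_{\alpha+1,m}\,y$. For $n\ge m\ge0$ and $j=n-m$, the degree $n$ type II exceptional Laguerre polynomial is $L^{\mathrm{II}(\alpha)}_{m,n}=-A^{\mathrm{II}}_{\alpha+1,m}\big[L^{(\alpha+1)}_{j}\big]$, i.e. $L^{\mathrm{II}(\alpha)}_{m,n}(z)=z\,L^{(-\alpha-1)}_m(z)L^{(\alpha+2)}_{j-1}(z)+(m-\alpha-1)L^{(-\alpha-2)}_m(z)L^{(\alpha+1)}_j(z)$.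 Its real positive zeros are called regular (for $\alpha>m-1$ there are exactly $n-m$ of them) and its remaining zeros, negative or complex, are called exceptional; all zeros are simple and $0$ is not a zero, so there are $m$ exceptional zeros. *)

(* Defs.v *)
From mathcomp Require Import all_boot all_order all_algebra.
From mathcomp Require Import ring complex.
From mathcomp Require Import all_classical all_reals all_analysis.

Set Implicit Arguments.
Unset Strict Implicit.
Unset Printing Implicit Defensive.

Import Order.TTheory GRing.Theory Num.Theory.
Import numFieldNormedType.Exports.

Local Open Scope ring_scope.

Section Laguerre.
Variable R : numFieldType.

(* x (x - 1) ... (x - k + 1) / k!, for arbitrary x *)
Definition gbinom (x : R) (k : nat) : R :=
  (\prod_(i < k) (x - i%:R)) / k`!%:R.

Definition laguerre (alpha : R) (n : nat) : {poly R} :=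
  \poly_(k < n.+1) (gbinom (n%:R + alpha) (n - k) * ((-1) ^+ k / k`!%:R)).

Definition eta (alpha : R) (m : nat) : {poly R} := laguerre (- alpha) m.

Definition A_II (alpha : R) (m : nat) (y : {poly R}) : {poly R} :=
  'X * eta alpha m * y^`() + (alpha - m%:R) *: (eta (alpha + 1) m * y).

(* Meaningful for m <= n only, because n - m is truncated. *)
Definition XLaguerre_II (alpha : R) (m n : nat) : {poly R} :=
  - A_II (alpha + 1) m (laguerre (alpha + 1) (n - m)).

Lemma deriv_laguerre (alpha : R) (n : nat) :
  (laguerre alpha n.+1)^`() = - laguerre (alpha + 1) n.
Proof.
apply/polyP => k; rewrite coefN coef_deriv !coef_poly ltnS.
case: ltnP => [kn|_]; last by rewrite mul0rn oppr0.
have -> : n.+1%:R + alpha = n%:R + (alpha + 1) :> R by rewrite -natr1; ring.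
rewrite subSS factS natrM exprS -[LHS]mulr_natr.
have hk : k`!%:R != 0 :> R by rewrite pnatr_eq0 -lt0n fact_gt0.
have hk1 : k.+1%:R != 0 :> R by rewrite pnatr_eq0.
by move: (k.+1%:R : R) (k`!%:R : R) hk1 hk => a b ha hb; field; rewrite ha hb.
Qed.

Lemma XLaguerre_IIE (alpha : R) (m n : nat) :
  XLaguerre_II alpha m n =
    'X * laguerre (- alpha - 1) m
       * (if (n - m)%N is j.+1 then laguerre (alpha + 2) j else 0)
  + (m%:R - alpha - 1)
      *: (laguerre (- alpha - 2) m * laguerre (alpha + 1) (n - m)).
Proof.
rewrite /XLaguerre_II /A_II /eta.
have -> : - (alpha + 1) = - alpha - 1 by ring.
have -> : - (alpha + 1 + 1) = - alpha - 2 by ring.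
rewrite opprD -scaleNr; congr (_ + _ *: _); last by ring.
case: (n - m)%N => [|j].
  rewrite (_ : laguerre _ 0 = ((laguerre (alpha + 1) 0)`_0)%:P).
    by rewrite derivC !mulr0 oppr0.
  by apply: size1_polyC; apply: size_poly.
rewrite deriv_laguerre mulrN opprK.
by have -> : alpha + 1 + 1 = alpha + 2 by ring.
Qed.

End Laguerre.

Section Zeros.
Variable R : realType.

Definition toC (p : {poly R}) : {poly R[i]} :=
  map_poly (real_complex R) p.

(* w lists the zeros of p in the complex plane, with multiplicity *)
Definition lists_zeros (p : {poly R}) (m : nat) (w : 'I_m -> R[i]) : Prop :=
  toC p = lead_coef (toC p) *: \prod_(i < m) ('X - (w i)%:P).

(* On R[i], 0 < z means that z is real and positive. *)
Definition exceptional_zero (alpha : R) (m n : nat) (z : R[i]) : bool :=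
  root (toC (XLaguerre_II alpha m n)) z && ~~ (0 < z).

End Zeros.

(* Main.v *)
(* Write L for the exceptional polynomial, y = L_j^(alpha+1) with j = n - m,
   eta = L_m^(-alpha-1) and c = alpha + 1 - m > 0. Everything rests on the identity
     L' - L = (j + c) eta y.
   Together with the definition of L it shows that all zeros of L are simple and,
   by sign changes, that L has exactly j positive zeros u_i, interlacing with the
   zeros x_i of y so that u_i < x_i. At a zero zeta of eta it gives L'(zeta) = L(zeta),
   where L(zeta) <> 0, that is
     sum_i 1/(zeta - u_i) + sum_exc 1/(zeta - z) = 1,
   the second sum having m terms. The first sum tends to infinity in modulus, so some
   exceptional zero z tends to zeta. For the first sum, the differential equation
   of y controls s(t) = sum_i 1/(t + x_i) at t = 1 and t = 4, which forces
   s(1) - s(4) = 3 sum_i 1/((1 + x_i)(4 + x_i)) to tend to infinity.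
   Finally eta has simple zeros, so that the m exceptional zeros are matched
   one to one with the zeros of eta. *)
Require Import Defs.
From mathcomp Require Import all_boot all_order all_algebra.
From mathcomp Require Import complex.
From mathcomp Require Import ring lra polyrcf separable.
From mathcomp Require Import all_classical all_reals all_analysis.
Import Order.TTheory GRing.Theory Num.Theory.
Import numFieldNormedType.Exports.
Local Open Scope ring_scope.

(** * Laguerre polynomials *)

Lemma gbinom0 (F : numFieldType) (x : F) : gbinom x 0 = 1.
Proof. by rewrite /gbinom big_ord0 fact0 divr1. Qed.

(** Both sides are x (x - 1) ... (x - k) / k!, with the last or the first factor split off. *)
Lemma gbinom_absorb (F : numFieldType) (x : F) (k : nat) :
  (x - k%:R) * gbinom x k = x * gbinom (x - 1) k.
Proof.
rewrite /gbinom !mulrA; congr (_ / _).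
have := big_ord_recr k (fun i : 'I_k.+1 => x - i%:R); rewrite mulrC => <-.
rewrite big_ord_recl subr0.
by congr (_ * _); apply: eq_bigr => i _; rewrite lift0 -natr1; ring.
Qed.

Lemma gbinomS (F : numFieldType) (x : F) (k : nat) :
  k.+1%:R * gbinom x k.+1 = (x - k%:R) * gbinom x k.
Proof.
rewrite /gbinom big_ord_recr /= factS natrM.
have hk : k`!%:R != 0 :> F by rewrite pnatr_eq0 -lt0n fact_gt0.
have hk1 : k.+1%:R != 0 :> F by rewrite pnatr_eq0.
by move: (k.+1%:R : F) (k`!%:R : F) hk1 hk => a b ha hb; field; rewrite ha hb.
Qed.

Lemma gbinom_pascal (F : numFieldType) (x : F) (k : nat) :
  gbinom (x + 1) k.+1 = gbinom x k.+1 + gbinom x k.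
Proof.
have hk1 : k.+1%:R != 0 :> F by rewrite pnatr_eq0.
apply: (mulfI hk1); rewrite mulrDr !gbinomS.
have := gbinom_absorb _ (x + 1) k; rewrite addrK => ->.
by rewrite -natr1; ring.
Qed.

Lemma coef_laguerre (F : numFieldType) (a : F) (n k : nat) :
  (laguerre a n)`_k =
  if (k <= n)%N then gbinom (n%:R + a) (n - k) * ((-1) ^+ k / k`!%:R) else 0.
Proof. by rewrite coef_poly ltnS. Qed.

Lemma coefn_laguerre (F : numFieldType) (a : F) (n : nat) :
  (laguerre a n)`_n = (-1) ^+ n / n`!%:R.
Proof. by rewrite coef_laguerre leqnn subnn gbinom0 mul1r. Qed.

Lemma size_laguerre (F : numFieldType) (a : F) (n : nat) :
  size (laguerre a n) = n.+1.
Proof.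
apply/eqP; rewrite eqn_leq size_poly ltnNge; apply/negP => /leq_sizeP/(_ n (leqnn n))/eqP.
apply/negP; rewrite coefn_laguerre mulf_neq0 ?signr_eq0 // invr_eq0 pnatr_eq0 -lt0n fact_gt0.
Qed.

Lemma laguerre_neq0 (F : numFieldType) (a : F) (n : nat) : laguerre a n != 0.
Proof. by rewrite -size_poly_eq0 size_laguerre. Qed.

Lemma laguerre0 (F : numFieldType) (a : F) : laguerre a 0 = 1.
Proof.
apply/polyP => k; rewrite coef_laguerre coef1 leqn0.
by case: eqP => [->|_] //; rewrite subnn gbinom0 expr0 fact0 divr1 mulr1.
Qed.

Lemma laguerre_contiguous (F : numFieldType) (a : F) (n : nat) :
  laguerre a n.+1 = laguerre (a + 1) n.+1 - laguerre (a + 1) n.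
Proof.
apply/polyP => k; rewrite coefB !coef_laguerre.
have -> : n.+1%:R + (a + 1) = n%:R + 1 + a + 1 :> F by rewrite -natr1; ring.
have -> : n%:R + (a + 1) = n%:R + 1 + a :> F by ring.
rewrite -natr1; case: (ltngtP k n.+1) => [|kn|->].
- by rewrite ltnS => kn; rewrite kn subSn // gbinom_pascal; ring.
- by rewrite leqNgt (ltnW kn) subr0.
- by rewrite ltnn subnn !gbinom0 subr0.
Qed.

Lemma deriv_laguerre_sub (F : numFieldType) (a : F) (n : nat) :
  (laguerre a n)^`() = laguerre a n - laguerre (a + 1) n.
Proof.
case: n => [|n]; first by rewrite !laguerre0 derivC subrr.
by rewrite deriv_laguerre laguerre_contiguous; ring.
Qed.

Lemma mulX_deriv_laguerre (F : numFieldType) (a : F) (n : nat) :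
  'X * (laguerre (a + 1) n)^`() =
  - ((a + 1) *: laguerre (a + 1) n) + (n%:R + a + 1) *: laguerre a n.
Proof.
apply/polyP => k; rewrite coefXM coefD coefN !coefZ coef_deriv !coef_laguerre.
have -> : (if k == 0%N then 0 else (if (k.-1 < n)%N then
   gbinom (n%:R + (a + 1)) (n - k.-1.+1) * ((-1) ^+ k.-1.+1 / (k.-1.+1)`!%:R)
   else 0) *+ k.-1.+1) = k%:R * (if (k <= n)%N then
   gbinom (n%:R + (a + 1)) (n - k) * ((-1) ^+ k / k`!%:R) else 0) :> F.
  by case: k => [|k] /=; rewrite ?mul0r // mulr_natl.
case: ifP => kn; last by rewrite !mulr0 oppr0 addr0.
have := gbinom_absorb _ (n%:R + (a + 1)) (n - k).
rewrite natrB // (_ : n%:R + (a + 1) - 1 = n%:R + a); last by ring.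
set g := gbinom _ _; set g' := gbinom _ _; set t := _ / _ => h.
have -> : (n%:R + a + 1) * (g' * t) = (n%:R + (a + 1)) * g' * t by ring.
by rewrite -h; ring.
Qed.

(** Raising operator: x^a e^(-x) times the left side is the derivative of x^(a+1) e^(-x) L_n^(a+1).
    It drives the induction that locates the zeros of the Laguerre polynomials. *)
Lemma laguerre_raise (F : numFieldType) (a : F) (n : nat) :
  'X * (laguerre (a + 1) n)^`() + ((a + 1)%:P - 'X) * laguerre (a + 1) n =
  n.+1%:R *: laguerre a n.+1.
Proof.
have h := mulX_deriv_laguerre F (a - 1) n.+1.
rewrite subrK deriv_laguerre mulrN in h.
have hx : 'X * laguerre (a + 1) n =
    a *: laguerre a n.+1 - (n.+1%:R + a) *: laguerre (a - 1) n.+1.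
  rewrite -[LHS]opprK h (_ : n.+1%:R + (a - 1) + 1 = n.+1%:R + a); last by ring.
  by rewrite opprD opprK.
rewrite mulX_deriv_laguerre mulrBl hx (laguerre_contiguous _ (a - 1)) subrK.
rewrite -!mul_polyC -natr1 !polyCD; ring.
Qed.

(** Lowering by [deriv_laguerre], then raising by [laguerre_raise]. *)
Lemma laguerre_ode (F : numFieldType) (a : F) (n : nat) :
  'X * (laguerre a n)^`()^`() + ((a + 1)%:P - 'X) * (laguerre a n)^`()
  + n%:R *: laguerre a n = 0.
Proof.
case: n => [|n]; first by rewrite laguerre0 derivC deriv0 !mulr0 scale0r !addr0.
rewrite deriv_laguerre derivN -laguerre_raise; ring.
Qed.

(** At z <> 0 the two first-order relations carry a common zero over to all derivatives of both
    polynomials, but the n-th derivative of the first is a nonzero constant. *)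
Lemma laguerre_no_common_root (F : numFieldType) (a : F) (n : nat) (z : F) :
  z != 0 -> root (laguerre a n) z -> ~~ root (laguerre (a + 1) n) z.
Proof.
move=> z0 pz; apply/negP => qz.
have vanish k : (laguerre a n)^`(k).[z] = 0 /\ (laguerre (a + 1) n)^`(k).[z] = 0.
  elim: k => [|k [IHp IHq]]; first by rewrite !derivn0; split; apply/eqP.
  split; first by rewrite derivSn deriv_laguerre_sub derivnB hornerD hornerN IHp IHq subrr.
  apply/(mulfI z0); rewrite mulr0.
  have /(congr1 (fun p => p^`(k).[z])) := mulX_deriv_laguerre F a n.
  rewrite derivnD derivnN !derivnZ hornerD hornerN !hornerZ IHp IHq !mulr0 oppr0 addr0.
  case: k IHq {IHp} => [|k] IHq; first by rewrite !derivn0 hornerM hornerX derivn1.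
  (* Brings the product to the shape of [derivnMXaddC]; of the two terms of the Leibniz rule, one
     vanishes by induction. *)
  rewrite -[_ * _]addr0 -[0]/(polyC 0) mulrC derivnMXaddC -derivSn hornerD hornerMn IHq.
  by rewrite mul0rn add0r hornerM hornerX mulrC -derivSn.
have [/eqP + _] := vanish n; apply/negP.
rewrite (@size1_polyC _ (laguerre a n)^`(n)); last first.
  by apply/leq_sizeP => i i0; rewrite coef_derivn coef_laguerre -{2}[n]addn0 leq_add2l
    leqNgt i0 mul0rn.
rewrite hornerC coef_derivn addn0 coefn_laguerre ffactnn mulrn_eq0 negb_or -lt0n fact_gt0.
by rewrite mulf_neq0 ?signr_eq0 // invr_eq0 pnatr_eq0 -lt0n fact_gt0.
Qed.

(** * The polynomials [eta] and the derivative of the exceptional polynomial *)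

Lemma deriv_eta (F : numFieldType) (alpha : F) (m : nat) :
  (eta (alpha + 1) m)^`() = eta (alpha + 1) m - eta alpha m.
Proof. by rewrite /eta deriv_laguerre_sub (_ : - (alpha + 1) + 1 = - alpha) //; ring. Qed.

Lemma mulX_deriv_eta (F : numFieldType) (alpha : F) (m : nat) :
  'X * (eta alpha m)^`() = alpha *: eta alpha m - (alpha - m%:R) *: eta (alpha + 1) m.
Proof.
have := mulX_deriv_laguerre F (- (alpha + 1)) m.
rewrite (_ : - (alpha + 1) + 1 = - alpha); last by ring.
rewrite /eta => ->; rewrite scaleNr opprK -scaleNr; congr (_ + _ *: _); ring.
Qed.

(* (e^(-z) L)' factors completely: this determines where the zeros of L lie. *)
Lemma deriv_XLaguerre (F : numFieldType) (alpha : F) (m n : nat) :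
  (XLaguerre_II alpha m n)^`() =
  XLaguerre_II alpha m n +
  ((n - m)%:R + alpha + 1 - m%:R) *: (eta (alpha + 1) m * laguerre (alpha + 1) (n - m)).
Proof.
rewrite /XLaguerre_II /A_II.
have h1 := mulX_deriv_eta F (alpha + 1) m.
have h2 := deriv_eta F (alpha + 1) m.
have := laguerre_ode F (alpha + 1) (n - m); move: h1 h2.
move: (laguerre _ _) (eta (alpha + 1) m) (eta (alpha + 1 + 1) m) => y e1 e2 h1 h2 h3.
have {}h3 : 'X * y^`()^`() = - (((alpha + 1 + 1)%:P - 'X) * y^`()) - (n - m)%:R *: y.
  by apply/eqP; rewrite -subr_eq0 -h3; apply/eqP; ring.
rewrite !(derivN, derivD, derivM, derivZ, derivX) mul1r.
have -> : (e1 + 'X * e1^`()) * y^`() + 'X * e1 * y^`()^`() =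
   (e1 + 'X * e1^`()) * y^`() + e1 * ('X * y^`()^`()) by ring.
rewrite h1 h3 h2 -!mul_polyC !(polyCD, polyCN); ring.
Qed.

(** At a double zero, [mulX_deriv_eta] would make [eta (alpha + 1) m] vanish too, which
    [laguerre_no_common_root] excludes. *)
Lemma root_eta_simple (F : numFieldType) (alpha : F) (m : nat) (z : F) :
  alpha != m%:R -> z != 0 -> root (eta alpha m) z -> (eta alpha m)^`().[z] != 0.
Proof.
move=> am z0 ez.
have /(congr1 (horner^~ z)) := mulX_deriv_eta F alpha m.
rewrite /= hornerM hornerX hornerD hornerN !hornerZ (rootP ez) mulr0 add0r => h.
have /negP : ~~ root (eta (alpha + 1) m) z.
  apply/negP => /(laguerre_no_common_root _ _ _ _ z0).
  by rewrite (_ : - (alpha + 1) + 1 = - alpha) ?ez //; ring.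
apply: contra_not_neq => d0; move/esym/eqP: h; rewrite d0 mulr0 oppr_eq0 mulf_eq0.
by rewrite subr_eq0 (negbTE am) /= => /eqP/rootP.
Qed.

Lemma gbinom_sign (R : numFieldType) (x : R) (k : nat) :
  x < 0 -> 0 < (-1) ^+ k * gbinom x k.
Proof.
move=> x0; rewrite /gbinom mulrA divr_gt0 ?ltr0n ?fact_gt0 //.
rewrite -{1}(card_ord k) -prodr_const -big_split /=.
apply: prodr_gt0 => i _; rewrite mulN1r opprB subr_gt0.
by apply: lt_le_trans x0 _.
Qed.

(** After multiplication by (-1)^m all coefficients are positive, because m - alpha < 0. The lemma
    is also applied over the complex numbers, where 0 <= x makes x real. *)
Lemma eta_sign (R : numFieldType) (alpha : R) (m : nat) (x : R) :
  m%:R < alpha -> 0 <= x -> 0 < (-1) ^+ m * (eta alpha m).[x].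
Proof.
move=> am x0; rewrite horner_poly mulr_sumr.
have t0 (k : nat) : (k <= m)%N ->
    0 < (-1) ^+ m * (gbinom (m%:R - alpha) (m - k) * ((-1) ^+ k / k`!%:R)).
  move=> km; rewrite -{1}(subnK km) exprD.
  rewrite (_ : _ * _ = ((-1) ^+ (m - k) * gbinom (m%:R - alpha) (m - k))
     * ((-1) ^+ k * (-1) ^+ k) / k`!%:R); last by rewrite !mulrA; ring.
  rewrite -expr2 sqrr_sign mulr1 divr_gt0 ?ltr0n ?fact_gt0 //.
  by apply: gbinom_sign; rewrite subr_lt0.
rewrite big_ord_recl expr0 mulr1 ltr_pwDl //; first exact: t0.
apply: sumr_ge0 => i _; rewrite mulrA mulr_ge0 ?exprn_ge0 //.
by apply/ltW/t0; rewrite lift0 ltn_ord.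
Qed.

(** * Positive zeros *)

(** The intermediate value theorem gives one zero in each gap between consecutive points. *)
Lemma alternating_roots (R : rcfType) (p : {poly R}) (x : R) (s : seq R) :
  path (fun u v => (u < v) && (p.[u] * p.[v] < 0)) x s ->
  exists r : seq R, [/\ path <%R x r, all (root p) r & all2 <%R r s].
Proof.
elim: s x => [|y s IH] x /=; first by exists [::].
case/andP=> /andP[xy pxy] /IH[r [r1 r2 r3]].
have [c] := poly_ivtoo (ltW xy) pxy; rewrite in_itv /= => /andP[xc cy] pc.
exists (c :: r); split=> /=; rewrite ?xc ?pc ?cy //.
by apply: path_le r1; [exact: lt_trans | exact: cy].
Qed.

Lemma deriv_prod_XsubC_neq0 (F : fieldType) (r : seq F) (x : F) :
  uniq r -> x \in r -> (\prod_(u <- r) ('X - u%:P))^`().[x] != 0.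
Proof.
move=> ur xr; apply: (coprimep_root (p := \prod_(u <- r) ('X - u%:P))).
  by have := separable_prod_XsubC r; rewrite ur separable_poly.unlock => ->.
by rewrite root_prod_XsubC.
Qed.

Lemma deriv_XsubCM (F : comNzRingType) (x u : F) (p : {poly F}) :
  (('X - x%:P) * p)^`().[u] = p.[u] + (u - x) * p^`().[u].
Proof. by rewrite derivM derivXsubC mul1r hornerD hornerM hornerXsubC. Qed.

Lemma path_lt_all (R : realDomainType) (x : R) (r : seq R) :
  path <%R x r -> all (fun u => x < u) r.
Proof. by move=> h; apply: order_path_min h; exact: lt_trans. Qed.

Lemma path_lt_uniq (R : realDomainType) (x : R) (r : seq R) :
  path <%R x r -> uniq r.
Proof. by move=> /(sorted_uniq lt_trans lt_irreflexive (s := x :: r)) /andP[]. Qed.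

(* The derivative of a product of distinct linear factors alternates in sign
   at its zeros, hence so does p. *)
Lemma path_alternating (R : realFieldType) (p : {poly R}) (x : R) (r : seq R) :
  path <%R x r ->
  (forall u, u \in x :: r -> 0 < p.[u] * (\prod_(u <- x :: r) ('X - u%:P))^`().[u]) ->
  path (fun u v => (u < v) && (p.[u] * p.[v] < 0)) x r /\ 0 < p.[last x r].
Proof.
elim: r x => [|x1 r IH] x /=.
  move=> _ /(_ x (mem_head _ _)).
  by rewrite big_cons big_nil mulr1 derivXsubC hornerC mulr1.
case/andP=> xx1 sr h; have r1 := path_lt_all _ _ _ sr.
have IHh u : u \in x1 :: r -> 0 < p.[u] * (\prod_(u <- x1 :: r) ('X - u%:P))^`().[u].
  move=> ur; have xu : 0 < u - x.
    rewrite subr_gt0; move: ur; rewrite inE => /predU1P[->//|ur].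
    by apply: lt_trans xx1 _; exact: (allP r1).
  have := h u; rewrite inE ur orbT big_cons deriv_XsubCM => /(_ isT).
  rewrite (rootP (_ : root (\prod_(u <- x1 :: r) ('X - u%:P)) u)) ?root_prod_XsubC //.
  by rewrite add0r mulrCA pmulr_rgt0.
have [-> ->] := IH x1 sr IHh; split=> //; rewrite xx1 andbT /=.
have := h x (mem_head _ _); have := IHh x1 (mem_head _ _).
rewrite big_cons deriv_XsubCM subrr mul0r addr0.
rewrite big_cons deriv_XsubCM subrr mul0r addr0 big_cons hornerM hornerXsubC.
set q := \prod_(u <- r) _.
(* Both [x] and [x1] lie to the left of all zeros of [q]. *)
have q0 : 0 < q.[x] * q.[x1].
  rewrite !horner_prod -big_split /= big_seq; apply: prodr_gt0 => u ur.
  rewrite !hornerXsubC nmulr_rgt0 subr_lt0; first exact: (allP r1).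
  by apply: lt_trans xx1 _; exact: (allP r1).
move=> h1 h2; rewrite -(pmulr_llt0 _ q0).
have -> : p.[x] * p.[x1] * (q.[x] * q.[x1]) = (p.[x1] * q.[x1]) * (p.[x] * q.[x]) by ring.
rewrite pmulr_rlt0 //; move: h2; rewrite mulrCA nmulr_rgt0 // subr_lt0 //.
Qed.

(** Induction on the degree with the parameter raised by one: [laguerre_raise] shows that
    L_(n+1)^(a) alternates in sign along 0 and the zeros of L_n^(a+1). *)
Lemma laguerre_positive_zeros (R : rcfType) (a : R) (n : nat) :
  -1 < a ->
  exists r : seq R, [/\ size r = n, path <%R 0 r &
    laguerre a n = lead_coef (laguerre a n) *: \prod_(u <- r) ('X - u%:P)].
Proof.
elim: n a => [|n IH] a a1.
  by exists [::]; rewrite big_nil laguerre0 lead_coef1 scale1r.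
have a2 : -1 < a + 1 by lra.
have [r [sr pr ry]] := IH _ a2.
set y := laguerre (a + 1) n in ry; set q := \prod_(u <- r) _ in ry.
set l := lead_coef y in ry.
have l0 : l != 0 by rewrite lead_coef_eq0 laguerre_neq0.
(* The factor [l] cancels the sign of the leading coefficient of [y]: at 0 and at the zeros of [q],
   [p] has the sign of the derivative of X q. *)
pose p := l *: laguerre a n.+1.
have ur : uniq (0 :: r) by apply: (sorted_uniq lt_trans lt_irreflexive).
have hx u : u \in 0 :: r -> 0 < p.[u] * (\prod_(u <- 0 :: r) ('X - u%:P))^`().[u].
  move=> hu; have := deriv_prod_XsubC_neq0 _ _ _ ur hu.
  have n0 : 0 < n.+1%:R :> R by rewrite ltr0n.
  rewrite big_cons -/q deriv_XsubCM subr0 hornerZ -(pmulr_rgt0 _ n0).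
  have /(congr1 (horner^~ u)) := laguerre_raise _ a n.
  rewrite /= -/y ry derivZ hornerZ hornerD !hornerM hornerX hornerD hornerN hornerC.
  rewrite hornerX !hornerZ; set L := (laguerre a n.+1).[u] => h d0.
  have -> : n.+1%:R * (l * L * (q.[u] + u * q^`().[u])) =
    (l * (q.[u] + u * q^`().[u])) * (n.+1%:R * L) by ring.
  rewrite -h; move: hu; rewrite inE => /predU1P[u0|hu].
    move: d0; rewrite u0 !mul0r !addr0 add0r subr0 => d0.
    have -> : l * q.[0] * ((a + 1) * (l * q.[0])) = (l * q.[0]) ^+ 2 * (a + 1) by ring.
    rewrite mulr_gt0 ?exprn_even_gt0 ?mulf_neq0 //; lra.
  have u0 : 0 < u by apply: (allP (path_lt_all _ _ _ pr)).
  move: d0; rewrite (rootP (_ : root q u)) ?root_prod_XsubC //.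
  rewrite !mulr0 !addr0 !add0r => d0.
  have -> : l * (u * q^`().[u]) * (u * (l * q^`().[u])) = (l * (u * q^`().[u])) ^+ 2 by ring.
  by rewrite exprn_even_gt0 // mulf_neq0.
have [hp lastp] := path_alternating _ p 0 r pr hx.
have lp : 0 < lead_coef (- p).
  rewrite lead_coefN lead_coefZ /l /y !lead_coefE !size_laguerre !coefn_laguerre /=.
  rewrite exprS mulN1r mulNr mulrN opprK mulrACA -expr2 sqrr_sign mul1r.
  by rewrite mulr_gt0 // invr_gt0 ltr0n fact_gt0.
have [M hM] := poly_pinfty_gt_lc lp.
(* A point beyond all zeros of [q] where [p] is already negative; it supplies the last of the n + 1
   sign changes. *)
pose M' := Num.max M (last 0 r + 1).
have pM : p.[M'] < 0.
  by rewrite -oppr_gt0 -hornerN; apply: lt_le_trans lp (hM _ _); rewrite le_max lexx.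
have lM : last 0 r < M' by rewrite lt_max ltrDl ltr01 orbT.
have : path (fun u v => (u < v) && (p.[u] * p.[v] < 0)) 0 (rcons r M').
  by rewrite rcons_path hp /= lM pmulr_rlt0.
move=> /alternating_roots[s [s1 s2 s3]]; exists s.
have ss : size s = n.+1.
  by move: s3; rewrite all2E size_rcons sr => /andP[/eqP].
split=> //; apply: all_roots_prod_XsubC; first by rewrite size_laguerre ss.
  by apply: sub_all s2 => u; rewrite rootZ.
by rewrite uniq_rootsE; exact: path_lt_uniq s1.
Qed.

(** * Logarithmic derivatives and splitting off positive zeros *)

Lemma deriv_prod_XsubC (F : fieldType) (r : seq F) (x : F) :
  x \notin r ->
  (\prod_(u <- r) ('X - u%:P))^`().[x] =
  (\prod_(u <- r) ('X - u%:P)).[x] * \sum_(u <- r) (x - u)^-1.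
Proof.
elim: r => [|u r IH]; first by rewrite !big_nil derivC hornerC mulr0.
rewrite inE negb_or => /andP[xu /IH xr].
have xu0 : x - u != 0 by rewrite subr_eq0.
by rewrite !big_cons deriv_XsubCM xr hornerM hornerXsubC; field.
Qed.

Lemma deriv2_prod_XsubC (F : fieldType) (r : seq F) (x : F) :
  x \notin r ->
  (\prod_(u <- r) ('X - u%:P))^`()^`().[x] =
  (\prod_(u <- r) ('X - u%:P)).[x] *
    ((\sum_(u <- r) (x - u)^-1) ^+ 2 - \sum_(u <- r) (x - u)^-2).
Proof.
elim: r => [|u r IH].
  by rewrite !big_nil derivC deriv0 horner0 expr0n subr0 mulr0.
rewrite inE negb_or => /andP[xu xr]; have d2 := IH xr.
have d1 := deriv_prod_XsubC _ _ _ xr.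
have xu0 : x - u != 0 by rewrite subr_eq0.
rewrite !big_cons derivM derivXsubC mul1r derivD hornerD deriv_XsubCM d1 d2 hornerM.
by rewrite hornerXsubC; field.
Qed.

(** Positive zeros are split off one at a time; simplicity keeps a zero from recurring in the
    cofactor. *)
Lemma positive_zeros (R : rcfType) (p : {poly R}) :
  p != 0 -> (forall v, 0 < v -> root p v -> p^`().[v] != 0) ->
  exists r g, [/\ path <%R 0 r, p = (\prod_(u <- r) ('X - u%:P)) * g &
    forall v, 0 < v -> ~~ root g v].
Proof.
move=> p0 sp.
suff [r [g [r0 ur -> g0]]] : exists r g, [/\ all (fun v => 0 < v) r, uniq r,
    p = (\prod_(u <- r) ('X - u%:P)) * g & forall v, 0 < v -> ~~ root g v].
  exists (sort <=%R r), g; split=> //; last first.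
    by congr (_ * _); apply: perm_big; rewrite perm_sym perm_sort.
  rewrite (path_sortedE lt_trans) sort_lt_sorted ur andbT.
  by apply/allP => u; rewrite mem_sort; apply: (allP r0).
have [k] := ubnP (size p); elim: k => // k IH in p p0 sp *; rewrite ltnS => pk.
have [|h] := pselect (exists2 u, 0 < u & root p u); last first.
  exists [::], p; rewrite big_nil mul1r; split=> // v v0.
  by apply/negP => pv; apply: h; exists v.
move=> [u u0 pu]; have /factor_theorem[q pq] := pu; rewrite mulrC in pq.
have q0 : q != 0 by apply: contra_neq p0 => q0; rewrite pq q0 mulr0.
have sq v : 0 < v -> root q v -> v != u /\ q^`().[v] != 0.
  move=> v0 qv; have /(sp v v0) : root p v by rewrite pq rootM qv orbT.
  rewrite pq deriv_XsubCM (rootP qv) add0r mulf_eq0 negb_or subr_eq0.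
  by case/andP.
have [] := IH q q0.
- by move=> v v0 /(sq v v0)[].
- by apply: leq_trans pk; rewrite pq size_monicM ?monicXsubC // size_XsubC.
move=> r [g [r0 ur qr g0]]; exists (u :: r), g; split=> //=.
- by rewrite u0.
- rewrite ur andbT; apply/negP => hur.
  have [|/eqP[]//] := sq u u0.
  by rewrite qr rootM root_prod_XsubC hur.
- by rewrite pq qr big_cons mulrA.
Qed.

Lemma all2_lt_last (R : realDomainType) (x : R) (s r : seq R) (v : R) :
  path <%R x r -> all2 <%R s r -> v \in s -> v < last x r.
Proof.
elim: r s x => [|y r IH] [|c s] x //= /andP[xy yr] /andP[cy sr].
rewrite inE => /predU1P[->|]; last exact: IH.
apply: lt_le_trans cy _; case: {IH sr} r yr => //= z r yr.
by apply/ltW/(allP (path_lt_all _ _ _ (yr : path _ y (z :: r)))); rewrite /= mem_last.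
Qed.

(** Sign changes are used twice: those of [L] along 0 and the zeros of [y] give enough zeros of [L],
    and those of [y] along the positive zeros of [L] show that there are no others. *)
Lemma XLaguerre_positive_zeros (R : rcfType) (alpha : R) (m n : nat) :
  m%:R - 1 < alpha ->
  exists x u : seq R, [/\ size x = (n - m)%N, path <%R 0 x,
    laguerre (alpha + 1) (n - m) =
      lead_coef (laguerre (alpha + 1) (n - m)) *: \prod_(v <- x) ('X - v%:P),
    path <%R 0 u /\ all2 <%R u x &
    (forall v, v \in x -> ~~ root (XLaguerre_II alpha m n) v) /\
    forall v, 0 < v -> root (XLaguerre_II alpha m n) v = (v \in u)].
Proof.
move=> am.
have a1 : -1 < alpha + 1 by have : 0 <= m%:R :> R by []; lra.
have [x [sx px]] := laguerre_positive_zeros _ _ (n - m) a1.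
set y := laguerre _ _; set l := lead_coef y; set q := \prod_(v <- x) _ => yq.
set L := XLaguerre_II alpha m n.
have l0 : l != 0 by rewrite lead_coef_eq0 laguerre_neq0.
have x0 v : v \in x -> 0 < v by apply: (allP (path_lt_all _ _ _ px)).
pose e1 v := (-1) ^+ m * (eta (alpha + 1) m).[v].
pose e2 v := (-1) ^+ m * (eta (alpha + 1 + 1) m).[v].
pose c := alpha + 1 - m%:R; have c0 : 0 < c by rewrite /c; lra.
have e1p v : 0 <= v -> 0 < e1 v by apply: eta_sign; lra.
have e2p v : 0 <= v -> 0 < e2 v by apply: eta_sign; lra.
(* The sign is chosen so that the coefficients [e1] and [e2] are positive on the nonnegative
   axis. *)
have LE v : (-1) ^+ m.+1 * L.[v] = l * (v * e1 v * q^`().[v] + c * e2 v * q.[v]).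
  rewrite /L /XLaguerre_II /A_II -/y yq derivZ hornerN hornerD hornerZ !hornerM hornerX.
  by rewrite !hornerZ exprS /e1 /e2 /c; ring.
have L'E v : (-1) ^+ m * (L^`().[v] - L.[v]) =
    ((n - m)%:R + alpha + 1 - m%:R) * (e1 v) * (l * q.[v]).
  rewrite /L deriv_XLaguerre -/L -/y yq hornerD hornerZ !hornerM hornerZ /e1; ring.
clearbody e1 e2.
have K0 : 0 < (n - m)%:R + alpha + 1 - m%:R :> R.
  by have : 0 <= (n - m)%:R :> R by []; lra.
have ux : uniq (0 :: x) by apply: (sorted_uniq lt_trans lt_irreflexive).
have q0 v : v \in x -> q.[v] = 0 by move=> vx; apply/rootP; rewrite root_prod_XsubC.
have q'0 v : v \in x -> q^`().[v] != 0.
  by move=> vx; apply: deriv_prod_XsubC_neq0 => //; case/andP: ux.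
(* At 0 only the [e2] term survives, at a zero of [y] only the [e1] term; in both cases a square
   times a positive number remains. *)
have hx v : v \in 0 :: x -> 0 < (l *: ((-1) ^+ m.+1 *: L)).[v] *
    (\prod_(u <- 0 :: x) ('X - u%:P))^`().[v].
  rewrite !hornerZ LE big_cons -/q deriv_XsubCM subr0 inE => /predU1P[->|vx].
    have -> : l * (l * (0 * e1 0 * q^`().[0] + c * e2 0 * q.[0])) * (q.[0] + 0 * q^`().[0])
      = (l * q.[0]) ^+ 2 * (c * e2 0) by ring.
    apply: mulr_gt0; last by rewrite mulr_gt0 ?e2p.
    rewrite exprn_even_gt0 // mulf_neq0 //.
    by rewrite -[_ == 0]/(root q 0) root_prod_XsubC; case/andP: ux.
  rewrite q0 // mulr0 addr0 add0r.
  have -> : l * (l * (v * e1 v * q^`().[v])) * (v * q^`().[v]) =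
    (l * v * q^`().[v]) ^+ 2 * e1 v by ring.
  have v0 := x0 _ vx.
  apply: mulr_gt0; last by rewrite e1p // ltW.
  by rewrite exprn_even_gt0 //= !mulf_neq0 ?q'0 ?(gt_eqF v0).
have [/alternating_roots[w [pw rw wx]] _] := path_alternating _ _ _ _ px hx.
have {rw} rw v : v \in w -> root L v.
  by move=> /(allP rw); rewrite !rootZ ?signr_eq0.
have L_neq0 : L != 0.
  apply/eqP => L0; have := hx 0 (mem_head _ _).
  by rewrite L0 !scaler0 horner0 mul0r ltxx.
have xL v : v \in x -> ~~ root L v.
  move=> vx; apply/negP => Lv; have v0 := x0 _ vx.
  have := LE v; rewrite (rootP Lv) mulr0 q0 // mulr0 addr0 => /esym/eqP.
  by rewrite !mulf_eq0 (negbTE l0) (gt_eqF v0) (gt_eqF (e1p _ (ltW v0))) (negbTE (q'0 _ vx)).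
have simpleL v : 0 < v -> root L v -> L^`().[v] != 0.
  move=> v0 Lv; apply/eqP => dL; have := L'E v.
  rewrite dL (rootP Lv) subrr mulr0 => /esym/eqP.
  rewrite !mulf_eq0 (gt_eqF K0) (gt_eqF (e1p _ (ltW v0))) (negbTE l0) /=.
  by rewrite -[_ == 0]/(root q v) root_prod_XsubC => /xL; rewrite Lv.
(* Beyond all zeros of [y], q and its logarithmic derivative leave both terms of [LE] with the same
   sign. *)
have beyond v : 0 < v -> (forall u, u \in x -> u < v) -> ~~ root L v.
  move=> v0 hv; apply/negP => Lv; have := LE v; rewrite (rootP Lv) mulr0 => /esym/eqP.
  apply/negP; rewrite mulf_neq0 // deriv_prod_XsubC -/q; last first.
    by apply/negP => /hv; rewrite ltxx.
  rewrite gt_eqF //.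
  have qv : 0 < q.[v].
    rewrite horner_prod big_seq; apply: prodr_gt0 => u ux'.
    by rewrite hornerXsubC subr_gt0 hv.
  apply: ltr_wpDl; last by rewrite !mulr_gt0 // e2p // ltW.
  rewrite !mulr_ge0 ?(ltW v0) ?(ltW qv) ?(ltW (e1p _ (ltW v0))) //.
  by rewrite big_seq sumr_ge0 // => u ux'; rewrite invr_ge0 subr_ge0 ltW // hv.
have [r [g [pr Lr g0]]] := positive_zeros _ _ L_neq0 simpleL.
have r0 v : v \in r -> 0 < v by apply: (allP (path_lt_all _ _ _ pr)).
have rL v : 0 < v -> root L v = (v \in r).
  by move=> v0; rewrite Lr rootM root_prod_XsubC (negbTE (g0 _ v0)) orbF.
have ur : uniq r := path_lt_uniq _ _ _ pr.
have uw : uniq w := path_lt_uniq _ _ _ pw.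
have sw : size w = (n - m)%N by rewrite -sx; move: wx; rewrite all2E => /andP[/eqP].
have wr : {subset w <= r}.
  by move=> v vw; rewrite -rL ?rw //; apply: (allP (path_lt_all _ _ _ pw)).
(* The list [w] already contains n - m positive zeros of [L], so a bound on their number finishes
   the proof. *)
suff sr : (size r <= n - m)%N.
  exists x, w; split=> //; split=> // v v0.
  have [_] := uniq_min_size uw wr (leq_trans sr (eq_leq (esym sw))).
  by move=> ->; exact: rL.
case: r => [|u0 r] //= in pr Lr r0 rL ur wr *.
case/andP: pr => u00 pr.
(* By the formula for L' - L, y alternates in sign along the positive zeros of L. *)
pose sg := (-1) ^+ m * g.[u0] * l.
have sgq v : v \in u0 :: r -> 0 < (sg *: q).[v] *
    (\prod_(u <- u0 :: r) ('X - u%:P))^`().[v].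
  move=> vr; have v0 := r0 _ vr; have := L'E v.
  set Q := \prod_(u <- u0 :: r) _.
  have Q0 : Q.[v] = 0 by apply/rootP; rewrite root_prod_XsubC.
  have Q'0 : Q^`().[v] != 0 by apply: deriv_prod_XsubC_neq0.
  rewrite Lr -/Q derivM hornerD !hornerM Q0 !mul0r addr0 subr0 hornerZ /sg => h.
  have ke : 0 < ((n - m)%:R + alpha + 1 - m%:R) * e1 v by rewrite mulr_gt0 // e1p // ltW.
  rewrite -(pmulr_rgt0 _ ke).
  have -> : ((n - m)%:R + alpha + 1 - m%:R) * e1 v *
     ((-1) ^+ m * g.[u0] * l * q.[v] * Q^`().[v]) =
     (((n - m)%:R + alpha + 1 - m%:R) * e1 v * (l * q.[v])) *
     ((-1) ^+ m * g.[u0] * Q^`().[v]) by ring.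
  rewrite -h.
  have -> : (-1) ^+ m * (Q^`().[v] * g.[v]) * ((-1) ^+ m * g.[u0] * Q^`().[v]) =
     ((-1) ^+ m * Q^`().[v]) ^+ 2 * (g.[u0] * g.[v]) by ring.
  apply: mulr_gt0; first by rewrite exprn_even_gt0 ?mulf_neq0 ?signr_eq0.
  (* [g] has no positive zero, so it keeps its sign between [u0] and [v]. *)
  rewrite ltNge; apply/negP => gg.
  have u0v : u0 <= v.
    move: vr; rewrite inE => /predU1P[->//|vr].
    by apply/ltW/(allP (path_lt_all _ _ _ pr)).
  have [t] := polyrcf.poly_ivt u0v gg; rewrite in_itv /= => /andP[tu _].
  by apply/negP/g0; exact: lt_le_trans tu.
have [/alternating_roots[s [ps rs sr]] _] := path_alternating _ _ _ _ pr sgq.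
have us : uniq s := path_lt_uniq _ _ _ ps.
have ss : size s = size r by move: sr; rewrite all2E => /andP[/eqP].
have sg0 : sg != 0.
  by rewrite !mulf_neq0 ?signr_eq0 //; exact: g0.
have sx' : {subset s <= x}.
  by move=> v /(allP rs); rewrite rootZ // root_prod_XsubC.
(* If [s] had n - m elements, it would exhaust the zeros of [y], and the last positive zero of [L]
   would lie beyond all of them, against [beyond]. *)
rewrite -ss ltnNge; apply/negP => hs.
have [_ sxE] := uniq_min_size us sx' (leq_trans (eq_leq sx) hs).
have last0 : last u0 r \in u0 :: r by exact: mem_last.
have : ~~ root L (last u0 r).
  by apply: beyond (r0 _ last0) _ => v; rewrite -sxE; apply: all2_lt_last.
by rewrite rL ?r0 // last0.
Qed.

(** * Growth of the logarithmic derivative *)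

(** The differential equation at -t, divided by the value of the polynomial there. *)
Lemma laguerre_log_derivative (R : realFieldType) (a t : R) (j : nat) (x : seq R) :
  0 < t -> all (fun v => 0 < v) x ->
  laguerre a j = lead_coef (laguerre a j) *: \prod_(v <- x) ('X - v%:P) ->
  j%:R = t * ((\sum_(v <- x) (t + v)^-1) ^+ 2 - \sum_(v <- x) (t + v)^-2)
    + (a + 1 + t) * \sum_(v <- x) (t + v)^-1.
Proof.
move=> t0 x0; set l := lead_coef _; set q := \prod_(v <- x) _ => yq.
have l0 : l != 0 by rewrite lead_coef_eq0 laguerre_neq0.
have tx : - t \notin x.
  by apply/negP => /(allP x0); rewrite oppr_gt0 ltNge (ltW t0).
have q0 : q.[- t] != 0 by rewrite -[_ == 0]/(root q _) root_prod_XsubC.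
have /(congr1 (horner^~ (- t))) := laguerre_ode _ a j.
rewrite yq !derivZ /= !(hornerD, hornerM, hornerN, hornerZ, hornerX, hornerC).
rewrite deriv2_prod_XsubC // deriv_prod_XsubC // -/q.
have -> : \sum_(v <- x) (- t - v)^-1 = - \sum_(v <- x) (t + v)^-1.
  by rewrite -sumrN; apply: eq_bigr => v _; rewrite -invrN opprD.
have -> : \sum_(v <- x) (- t - v)^-2 = \sum_(v <- x) (t + v)^-2.
  by apply: eq_bigr => v _; rewrite -opprD sqrrN.
set s := \sum_(v <- x) _; set s2 := \sum_(v <- x) _ => h.
have : l * q.[- t] * (t * (s ^+ 2 - s2) + (a + 1 + t) * s - j%:R) = 0.
  by rewrite -[RHS]oppr0 -h; ring.
move/eqP; rewrite !mulf_eq0 (negbTE l0) (negbTE q0) /= subr_eq0 => /eqP ->.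
by [].
Qed.

(** Heuristically s(t) is close to the square root of j / t, so s(1) is about 2 s(4). The summand is
    a third of 1/(1 + v) - 1/(4 + v), which turns the sum into (s(1) - s(4)) / 3. *)
Lemma laguerre_zeros_sum_large (R : realType) (a B : R) :
  -1 < a -> exists N : nat, forall (j : nat) (x : seq R), (N <= j)%N ->
  all (fun v => 0 < v) x ->
  laguerre a j = lead_coef (laguerre a j) *: \prod_(v <- x) ('X - v%:P) ->
  B < \sum_(v <- x) ((1 + v) * (4 + v))^-1.
Proof.
(* Chosen so that s1 > M and 2 s4 <= s1 + (a + 2) / 2 together give s1 - s4 > 3 |B|. *)
move=> a1; pose M := 6 * `|B| + (a + 2).
have M0 : 0 <= M by have := normr_ge0 B; rewrite /M; lra.
have X0 : 0 <= M ^+ 2 + (a + 2) * M.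
  by rewrite addr_ge0 ?mulr_ge0 ?exprn_ge0 //; lra.
exists (Num.bound (M ^+ 2 + (a + 2) * M)) => j x Nj x0 yq.
have jM : M ^+ 2 + (a + 2) * M < j%:R.
  by apply: lt_le_trans (archi_boundP X0) _; rewrite ler_nat.
have h1 := laguerre_log_derivative _ _ 1 _ _ ltr01 x0 yq.
have h4 := laguerre_log_derivative _ _ 4 _ _ (ltr0n _ 4) x0 yq.
move: h1 h4.
set s1 := \sum_(v <- x) (1 + v)^-1; set q1 := \sum_(v <- x) (1 + v)^-2.
set s4 := \sum_(v <- x) (4 + v)^-1; set q4 := \sum_(v <- x) (4 + v)^-2 => h1 h4.
have s1p : 0 <= s1.
  by rewrite /s1 big_seq sumr_ge0 // => v /(allP x0) v0; rewrite invr_ge0; lra.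
have s4p : 0 <= s4.
  by rewrite /s4 big_seq sumr_ge0 // => v /(allP x0) v0; rewrite invr_ge0; lra.
have q1p : 0 <= q1.
  by rewrite /q1 big_seq sumr_ge0 // => v _; rewrite invr_ge0 sqr_ge0.
have q4s : 4 * q4 <= s4.
  rewrite /q4 /s4 mulr_sumr !big_seq ler_sum // => v /(allP x0) v0.
  have v4 : 0 < 4 + v by lra.
  rewrite expr2 invfM mulrA -[leRHS]mul1r ler_wpM2r ?invr_ge0 ?(ltW v4) //.
  by rewrite ler_pdivrMr // mul1r; lra.
have -> : \sum_(v <- x) ((1 + v) * (4 + v))^-1 = (s1 - s4) / 3.
  rewrite /s1 /s4 -sumrB mulr_suml !big_seq; apply: eq_bigr => v /(allP x0) v0.
  by field; apply/andP; split; lra.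
(* As [q1] is nonnegative, [h1] gives j <= s1^2 + (a + 2) s1. *)
have Ms : M < s1.
  rewrite ltNge; apply/negP => sM; nra.
(* Otherwise 4 s4^2 > s1^2 + (a + 2) s1, while [h1], [h4] and [q4s] give 4 s4^2 + (a + 4) s4 <= s1^2
   + (a + 2) s1. *)
have s14 : 2 * s4 <= s1 + (a + 2) / 2.
  rewrite leNgt; apply/negP => hlt; nra.
have := ler_norm B; rewrite /M in Ms; lra.
Qed.

Lemma Re_imulV (R : rcfType) (a b v : R) :
  complex.Re ('i%C * ((a +i* b)%C - v%:C%C)^-1) = b / ((a - v) ^+ 2 + b ^+ 2).
Proof.
by rewrite mulrC ReiNIm /= subr0 opprK.
Qed.

Lemma Re_oppV (R : rcfType) (a v : R) :
  complex.Re (- 1 * ((a +i* 0)%C - v%:C%C)^-1) = - (a - v)^-1.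
Proof.
rewrite mulN1r /= subr0 expr0n addr0 -/(_ - _).
have [->|av] := eqVneq (a - v) 0; first by rewrite invr0 mul0r oppr0.
by field.
Qed.

(** For z off the nonnegative real axis, one unit factor (-1, i or -i) turns all the numbers 1/(z -
    v) into the right half plane, so their real parts cannot cancel. *)
Lemma Cauchy_sum_lower (R : rcfType) (z : R[i]) :
  ~~ (0 <= z) -> exists2 k : R, 0 < k & forall u : seq R, all (fun v => 0 < v) u ->
  (k * \sum_(v <- u) ((1 + v) * (4 + v))^-1)%:C%C <= `|\sum_(v <- u) (z - v%:C%C)^-1|.
Proof.
move=> z0.
suff [w [k [w1 k0 hk]]] : exists (w : R[i]) (k : R), [/\ `|w| = 1, 0 < k & forall v : R, 0 < v ->
    k * ((1 + v) * (4 + v))^-1 <= complex.Re (w * (z - v%:C%C)^-1)].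
  exists k => // u u0.
  rewrite -[leRHS]mul1r -w1 -normrM [w * _]mulr_sumr.
  apply: le_trans (normc_ge_Re _); rewrite lecR; apply: le_trans (ler_norm _).
  have ReD : {morph @complex.Re R : x y / x + y} by case=> ? ? [].
  rewrite (big_morph _ ReD (erefl : complex.Re 0 = 0)) mulr_sumr !big_seq.
  by apply: ler_sum => v /(allP u0)/hk.
case: z z0 => a b; rewrite lecE /=.
have i1 : `|'i%C| = 1 :> R[i] by rewrite normc_def /= expr0n expr1n add0r sqrtr1.
have [b0|] := eqVneq b 0.
  (* Here z = a < 0, and v - a <= (1 - a) (1 + v) (4 + v). *)
  rewrite b0 -ltNge => a0; exists (-1), (1 - a)^-1; split.
  - by rewrite normrN1.
  - by rewrite invr_gt0; lra.
  move=> v v0; rewrite Re_oppV -invrN -invfM lef_pV2 ?posrE.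
  - nra.
  - by rewrite !mulr_gt0 //; lra.
  - lra.
(* By (a - v)^2 <= 2 a^2 + 2 v^2, this [K] satisfies (a - v)^2 + b^2 <= K (1 + v) (4 + v). *)
move=> b0 _; pose K := 2 + 2 * a ^+ 2 + b ^+ 2.
have K0 : 0 < K by rewrite /K; have := sqr_ge0 a; have := sqr_ge0 b; lra.
have main (v : R) : 0 < v ->
    `|b| / K * ((1 + v) * (4 + v))^-1 <= `|b| / ((a - v) ^+ 2 + b ^+ 2).
  move=> v0; rewrite -mulrA -invfM ler_wpM2l // lef_pV2 ?posrE.
  - have := sqr_ge0 (a + v); have := sqr_ge0 a; have := sqr_ge0 b; have := sqr_ge0 v.
    rewrite /K !expr2 => h1 h2 h3 h4.
    have h5 : 0 <= a * a * v by rewrite mulr_ge0 // ltW.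
    have h6 : 0 <= b * b * v by rewrite mulr_ge0 // ltW.
    have h7 : 0 <= a * a * (v * v) by rewrite mulr_ge0.
    have h8 : 0 <= b * b * (v * v) by rewrite mulr_ge0.
    nra.
  - by rewrite !mulr_gt0 //; lra.
  - by rewrite ltr_wpDl ?sqr_ge0 // exprn_even_gt0.
have Kb : 0 < `|b| / K by rewrite divr_gt0 // normr_gt0.
case: (ltrgt0P b) b0 => // bs _.
- exists 'i%C, (`|b| / K); split=> // v v0.
  by have := main v v0; rewrite Re_imulV (gtr0_norm bs).
- exists (- 'i%C), (`|b| / K); split=> //; first by rewrite normrN.
  move=> v v0; have ReN x : complex.Re (- x) = - complex.Re x :> R by case: x.
  rewrite mulNr ReN Re_imulV -mulNr.
  by have := main v v0; rewrite (ltr0_norm bs).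
Qed.

(** * Complex zeros *)

Lemma toC_laguerre (R : realType) (a : R) (n : nat) :
  toC (laguerre a n) = laguerre a%:C%C n.
Proof.
apply/polyP => k; rewrite coef_map /= !coef_laguerre; case: ifP => // _.
rewrite rmorphM; congr (_ * _); last by rewrite fmorph_div rmorphXn rmorphN1 rmorph_nat.
rewrite /gbinom fmorph_div rmorph_nat rmorph_prod; congr (_ / _).
by apply: eq_bigr => i _; rewrite rmorphB rmorphD !rmorph_nat.
Qed.

Lemma toC_eta (R : realType) (alpha : R) (m : nat) :
  toC (eta alpha m) = eta alpha%:C%C m.
Proof. by rewrite /eta toC_laguerre rmorphN. Qed.

Lemma toC_XLaguerre (R : realType) (alpha : R) (m n : nat) :
  toC (XLaguerre_II alpha m n) = XLaguerre_II alpha%:C%C m n.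
Proof.
rewrite /XLaguerre_II /A_II /toC rmorphN rmorphD !rmorphM /= map_polyX map_polyZ rmorphM /=.
rewrite -deriv_map -!/(toC _) !toC_eta !toC_laguerre.
by rewrite rmorphB !rmorphD rmorph1 rmorph_nat.
Qed.

Lemma toC_prod_XsubC (R : realType) (x : seq R) :
  toC (\prod_(v <- x) ('X - v%:P)) = \prod_(z <- [seq v%:C%C | v <- x]) ('X - z%:P).
Proof.
rewrite /toC rmorph_prod big_map; apply: eq_bigr => v _.
by rewrite rmorphB /= map_polyX map_polyC.
Qed.

Lemma uniq_prod_XsubC (F : closedFieldType) (r : seq F) :
  (forall z, z \in r -> (\prod_(u <- r) ('X - u%:P))^`().[z] != 0) -> uniq r.
Proof.
move=> h; rewrite -separable_prod_XsubC separable_poly.unlock.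
by apply/Pdiv.ClosedField.coprimepP => z; rewrite root_prod_XsubC => /h.
Qed.

Lemma eta_root_not_ge0 (F : numFieldType) (alpha : F) (m : nat) (z : F) :
  m%:R < alpha -> root (eta alpha m) z -> ~~ (0 <= z).
Proof.
move=> am /rootP ez; apply/negP => /(eta_sign _ _ _ _ am).
by rewrite ez mulr0 ltxx.
Qed.

(** The degree is read off from L' - L, which has the degree of L and factors by
    [deriv_XLaguerre]. *)
Lemma size_XLaguerre (F : numFieldType) (alpha : F) (m n : nat) :
  (m <= n)%N -> (n - m)%:R + alpha + 1 - m%:R != 0 ->
  size (XLaguerre_II alpha m n) = n.+1.
Proof.
move=> mn K0; have := deriv_XLaguerre F alpha m n; set L := XLaguerre_II _ _ _ => dL.
have L0 : L != 0.
  apply/eqP => L0; move/esym/eqP: dL; rewrite L0 deriv0 add0r scaler_eq0 (negbTE K0).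
  by rewrite mulf_eq0 !(negbTE (laguerre_neq0 _ _ _)).
have -> : size L = size (L^`() - L).
  by rewrite addrC -[RHS]size_polyN opprD opprK size_polyDl // size_polyN lt_size_deriv.
rewrite dL addrC addKr size_scale // size_mul ?laguerre_neq0 //.
by rewrite !size_laguerre addnS /= addSn subnKC.
Qed.

(** A double zero would be a zero of eta y. It is not one of y, whose zeros are positive and not
    zeros of L; at a zero of eta, the definition of L would force [eta (alpha + 1 + 1) m] to vanish
    as well. *)
Lemma XLaguerre_simple (R : realType) (alpha : R) (m n : nat) (z : R[i]) :
  m%:R - 1 < alpha -> root (toC (XLaguerre_II alpha m n)) z ->
  (toC (XLaguerre_II alpha m n))^`().[z] != 0.
Proof.
move=> am; have [x [u [_ px yx _ [xL _]]]] := XLaguerre_positive_zeros R alpha m n am.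
move=> Lz; apply/eqP => dL.
have Kr : (n - m)%:R + alpha + 1 - m%:R != 0 :> R.
  by have : 0 <= (n - m)%:R :> R by []; move=> ?; apply/eqP; lra.
have K0 : (n - m)%:R + alpha%:C%C + 1 - m%:R != 0.
  move: Kr; rewrite -(inj_eq (@complexI R)) rmorphB !rmorphD !rmorph_nat rmorph1 rmorph0.
  by [].
have amC : m%:R < alpha%:C%C + 1.
  by rewrite -(rmorph_nat (real_complex R)) -(rmorph1 (real_complex R)) -rmorphD ltcR; lra.
have yz : (laguerre (alpha%:C%C + 1) (n - m)).[z] != 0.
  apply/negP; rewrite -(rmorph1 (real_complex R)) -rmorphD -toC_laguerre yx.
  rewrite -[_ == 0]/(root (toC _) z) /toC map_polyZ rootZ; last first.
    by rewrite fmorph_eq0 lead_coef_eq0 laguerre_neq0.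
  rewrite -/(toC _) toC_prod_XsubC root_prod_XsubC => /mapP[v vx zv].
  move: Lz; rewrite zv /root horner_map fmorph_eq0.
  by apply/negP; apply: xL.
have := deriv_XLaguerre _ alpha%:C%C m n; rewrite -toC_XLaguerre => /(congr1 (horner^~ z)).
rewrite /= dL hornerD (rootP Lz) add0r hornerZ hornerM => /esym/eqP.
rewrite !mulf_eq0 (negbTE K0) (negbTE yz) orbF /= => ez.
have z0 : z != 0.
  by apply: contraNneq (eta_root_not_ge0 _ _ _ _ amC ez) => ->.
move: Lz; rewrite toC_XLaguerre /XLaguerre_II /A_II rootE hornerN hornerD !hornerM.
rewrite hornerX (eqP ez) mulr0 mul0r add0r hornerZ hornerM oppr_eq0 !mulf_eq0 (negbTE yz).
rewrite orbF subr_eq0 (gt_eqF amC) /= => /(laguerre_no_common_root _ _ _ _ z0)/negP; apply.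
rewrite (_ : - _ + 1 = - (alpha%:C%C + 1)) //; ring.
Qed.

(** By degree and simplicity there are n distinct complex zeros; the positive ones are the n - m
    elements of [u], so m are left for [E]. *)
Lemma XLaguerre_zeros (R : realType) (alpha : R) (m n : nat) :
  m%:R - 1 < alpha -> (m <= n)%N ->
  exists (x u : seq R) (E : seq R[i]), [/\
    all (fun v => 0 < v) x /\ laguerre (alpha + 1) (n - m) =
      lead_coef (laguerre (alpha + 1) (n - m)) *: \prod_(v <- x) ('X - v%:P),
    all (fun v => 0 < v) u /\ all2 <%R u x,
    uniq E /\ size E = m,
    forall z, exceptional_zero alpha m n z = (z \in E) &
    toC (XLaguerre_II alpha m n) = lead_coef (toC (XLaguerre_II alpha m n)) *:
      \prod_(z <- [seq v%:C%C | v <- u] ++ E) ('X - z%:P)].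
Proof.
move=> am mn.
have [x [u [sx px yx [pu ux] [_ uL]]]] := XLaguerre_positive_zeros R alpha m n am.
have [Z LZ] := closed_field_poly_normal (toC (XLaguerre_II alpha m n)).
set L := XLaguerre_II alpha m n in uL LZ *.
have Kr : (n - m)%:R + alpha + 1 - m%:R != 0 :> R.
  by have : 0 <= (n - m)%:R :> R by []; move=> ?; apply/eqP; lra.
have sL : size (toC L) = n.+1 by rewrite size_map_poly size_XLaguerre.
have l0 : lead_coef (toC L) != 0 by rewrite lead_coef_eq0 -size_poly_eq0 sL.
have LZE z : root (toC L) z = (z \in Z) by rewrite LZ rootZ // root_prod_XsubC.
have uZ : uniq Z.
  apply: uniq_prod_XsubC => z; rewrite -LZE => /(XLaguerre_simple R alpha m n z am).
  by rewrite -/L LZ derivZ hornerZ mulf_eq0 negb_or => /andP[].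
have sZ : size Z = n.
  by apply: succn_inj; rewrite -sL LZ size_scale // size_prod_XsubC.
have pu0 := path_lt_all _ _ _ pu.
have uu : uniq u := path_lt_uniq _ _ _ pu.
exists x, u, [seq z <- Z | ~~ (0 < z)].
have permu : perm_eq [seq v%:C%C | v <- u] [seq z <- Z | 0 < z].
  apply: uniq_perm; [by rewrite map_inj_uniq //; exact: complexI|exact: filter_uniq|].
  move=> z; rewrite mem_filter -LZE; apply/mapP/andP => [[v vu ->]|[z0 Lz]].
    have v0 := allP pu0 _ vu.
    by rewrite ltcR; split=> //; rewrite /root horner_map fmorph_eq0 -[_ == 0]/(root L v) uL.
  have zE : z = (complex.Re z)%:C%C by rewrite RRe_real // gtr0_real.
  exists (complex.Re z) => //; rewrite -uL; last by rewrite -ltcR -zE.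
  by move: Lz; rewrite {1}zE /root horner_map fmorph_eq0.
split=> //.
- by split=> //; apply: path_lt_all.
- split; first exact: filter_uniq.
  have := perm_size permu; rewrite size_map => su.
  have := perm_size (permEl (perm_filterC (fun z : R[i] => 0 < z) Z)).
  rewrite size_cat -su sZ; move: ux; rewrite all2E sx => /andP[/eqP -> _] h.
  by apply/eqP; rewrite -(eqn_add2l (n - m)) subnK //; apply/eqP.
- by move=> z; rewrite mem_filter -LZE andbC.
- rewrite {1}LZ; congr (_ *: _); apply: perm_big.
  by rewrite perm_sym (perm_trans _ (permEl (perm_filterC (fun z => 0 < z) Z))) // perm_cat2r.
Qed.

(** * Exceptional zeros near the zeros of eta *)

Lemma ler_sum_all2 (R : realFieldType) (f : R -> R) (u x : seq R) :
  (forall v w, 0 < v -> v < w -> f w <= f v) ->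
  all (fun v => 0 < v) u -> all2 <%R u x ->
  \sum_(w <- x) f w <= \sum_(v <- u) f v.
Proof.
move=> hf; elim: u x => [|v u IH] [|w x] //= /andP[v0 u0] /andP[vw ux].
by rewrite !big_cons lerD ?hf ?IH.
Qed.

Lemma exceptional_zero_near (R : realType) (alpha : R) (m : nat) (z : R[i]) (e : R) :
  m%:R - 1 < alpha -> root (toC (eta (alpha + 1) m)) z -> 0 < e ->
  exists N : nat, forall n : nat, (N <= n)%N -> (m <= n)%N ->
  exists2 w : R[i], exceptional_zero alpha m n w & `|w - z| < e%:C%C.
Proof.
move=> am ez e0.
have a1 : -1 < alpha + 1 by have : 0 <= m%:R :> R by []; lra.
have amC : m%:R < alpha%:C%C + 1.
  by rewrite -(rmorph_nat (real_complex R)) -(rmorph1 (real_complex R)) -rmorphD ltcR; lra.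
have ezC : root (eta (alpha%:C%C + 1) m) z.
  by move: ez; rewrite toC_eta rmorphD rmorph1.
have zge0 := eta_root_not_ge0 _ _ _ _ amC ezC.
have [k k0 hk] := Cauchy_sum_lower R z zge0.
(* After multiplication by [k] this bound makes the sum over the positive zeros exceed 1 + m / e in
   modulus. If all m exceptional zeros were at distance at least e, their sum would be at most m /
   e, and the total could not be 1. *)
have [N hN] := laguerre_zeros_sum_large R _ ((1 + m%:R / e) / k) a1.
exists (N + m)%N => n Nn mn.
have Nj : (N <= n - m)%N by rewrite leq_subRL // addnC.
have [x [u [E [[x0 yx] [u0 ux] [uE sE] EE]]]] := XLaguerre_zeros R alpha m n am mn.
set L := toC _; set l := lead_coef L; set r := _ ++ E => LE.
have := hN _ _ Nj x0 yx; rewrite ltr_pdivrMr // => hx.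
(* The summand decreases in v and u_i < x_i, so the bound passes from the zeros of y to those of
   L. *)
have hu : 1 + m%:R / e < k * \sum_(v <- u) ((1 + v) * (4 + v))^-1.
  apply: lt_le_trans hx _; rewrite mulrC ler_pM2l //; apply: ler_sum_all2 => // v w v0 vw.
  by rewrite lef_pV2 ?posrE; [apply: ler_pM; lra|rewrite mulr_gt0 //; lra..].
apply: contrapT => far.
have {}far w : w \in E -> e%:C%C <= `|z - w|.
  move=> wE; rewrite real_leNgt ?normr_real ?complex_real ?eqxx //; apply/negP => h.
  by apply: far; exists w; rewrite ?EE // distrC.
have Lz : ~~ root L z.
  apply/negP => Lz.
  have /far : z \in E.
    by rewrite -EE /exceptional_zero Lz /=; apply: contra zge0 => /ltW.
  by rewrite subrr normr0 lecR leNgt e0.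
have L0 : L.[z] != 0 by [].
have zr : z \notin r.
  by apply: contra Lz => zr; rewrite LE rootZ ?root_prod_XsubC // lead_coef_eq0;
     apply: contraNneq L0 => ->; rewrite horner0.
have dL : L^`().[z] = L.[z].
  rewrite /L toC_XLaguerre deriv_XLaguerre hornerD hornerZ hornerM.
  by rewrite (rootP ezC) mul0r mulr0 addr0.
have := deriv_prod_XsubC _ _ _ zr.
move: dL; rewrite LE derivZ !hornerZ => dL dP.
have P0 : l * (\prod_(v <- r) ('X - v%:P)).[z] != 0 by rewrite -hornerZ -LE.
have : \sum_(v <- r) (z - v)^-1 = 1.
  by apply: (mulfI P0); rewrite mulr1 -mulrA -dP.
rewrite big_cat big_map /= => sumE.
have nE : `|\sum_(v <- E) (z - v)^-1| <= (m%:R / e)%:C%C.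
  apply: le_trans (ler_norm_sum _ _ _) _.
  apply: (@le_trans _ _ (\sum_(v <- E) (e^-1)%:C%C)).
    rewrite !big_seq; apply: ler_sum => v /far vE.
    rewrite normfV fmorphV lef_pV2 ?posrE //; last by rewrite ltcR.
    by apply: lt_le_trans vE; rewrite ltcR.
  by rewrite big_const_seq count_predT iter_addr_0 sE -rmorphMn lecR -mulr_natl.
have nu := hk _ u0.
have : (1 + m%:R / e)%:C%C < (1 + m%:R / e)%:C%C :> R[i]; last by rewrite ltxx.
apply: (@lt_le_trans _ _ (k * \sum_(v <- u) ((1 + v) * (4 + v))^-1)%:C%C); first by rewrite ltcR.
apply: le_trans nu _.
have -> : \sum_(v <- u) (z - v%:C%C)^-1 = 1 - \sum_(v <- E) (z - v)^-1.
  by rewrite -[X in X - _]sumE addrK.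
apply: le_trans (ler_normB _ _) _; rewrite normr1 rmorphD rmorph1 lerD2l //.
Qed.

(** * Labelling and convergence *)

Local Open Scope classical_set_scope.

(* Sending i to the index of the point of v n closest to w i is eventually a permutation. *)
Lemma relabel_cvg (R : realType) (m : nat) (w : 'I_m -> R[i]) (v : nat -> 'I_m -> R[i]) :
  injective w ->
  (forall (i : 'I_m) (e : R), 0 < e ->
     \forall n \near \oo, exists k, `|v n k - w i| < e%:C%C) ->
  exists s : nat -> 'I_m -> 'I_m, (forall n, injective (s n)) /\
    forall i, v n (s n i) @[n --> \oo] --> (w i : R[i]^o).
Proof.
move=> winj hv.
(* The modulus is an element of R[i]; its real part lives in a total order, as the minimum
   requires. *)
pose dist n i k : R := complex.Re `|v n k - w i|.
pose f n i : 'I_m := [arg min_(k < i) dist n i k]%O.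
have distE n i k : (dist n i k)%:C%C = `|v n k - w i| by rewrite RRe_real ?normr_real.
have fP n i (e : R) : (exists k, `|v n k - w i| < e%:C%C) -> `|v n (f n i) - w i| < e%:C%C.
  case=> k; rewrite -!distE !ltcR; apply: le_lt_trans.
  by rewrite /f; case: arg_minP => // j _; apply.
have fcvg i (e : R) : 0 < e -> \forall n \near \oo, `|v n (f n i) - w i| < e%:C%C.
  by move=> e0; apply: filterS (hv i e e0) => n; exact: fP.
have finj : \forall n \near \oo, forall p : 'I_m * 'I_m, f n p.1 = f n p.2 -> p.1 = p.2.
  apply: filter_forall => -[i k] /=.
  have [->|ik] := eqVneq i k; first by apply: nearW.
  (* Half the distance of two limits: a point within [d] of both cannot exist. *)
  pose d : R := complex.Re `|w i - w k| / 2.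
  have dE : d%:C%C + d%:C%C = `|w i - w k|.
    by rewrite -rmorphD /d -splitr; apply: RRe_real; exact: normr_real.
  have d0 : 0 < d.
    rewrite divr_gt0 // -ltcR RRe_real ?normr_real // normr_gt0 subr_eq0.
    by apply: contra_neq ik => /winj.
  near=> n => fE; exfalso.
  have : `|w i - w k| < d%:C%C + d%:C%C; last by rewrite dE ltxx.
  have -> : w i - w k = (v n (f n k) - w k) - (v n (f n i) - w i) by rewrite fE; ring.
  apply: le_lt_trans (ler_normB _ _) _; rewrite ltrD //.
    by near: n; exact: fcvg.
  by near: n; exact: fcvg.
(* For the finitely many n where [f n] may fail to be injective, the identity keeps [s n] a
   permutation. *)
pose s n := if `[< injective (f n) >] then f n else id.
exists s; split.
  by move=> n; rewrite /s; case: asboolP => // _; exact: inj_id.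
move=> i; apply: (proj2 (@cvgrPdist_lt R[i] R[i]^o nat \oo _ (fun n => v n (s n i)) (w i))) => e e0.
have eE : e = (complex.Re e)%:C%C by rewrite RRe_real ?gtr0_real.
have e0' : 0 < complex.Re e by rewrite -ltcR -eE.
near=> n.
have fninj : injective (f n).
  have h : forall p : 'I_m * 'I_m, f n p.1 = f n p.2 -> p.1 = p.2 by near: n.
  by move=> j k; exact: (h (j, k)).
rewrite /s asboolT // distrC eE; near: n; exact: fcvg.
Unshelve. all: by end_near. Qed.

Theorem proposition4p7 (R : realType) (m : nat) (alpha : R)
    (alpha_gt : m%:R - 1 < alpha)
    (w : 'I_m -> R[i])
    (w_zeros : lists_zeros (eta (alpha + 1) m) w) :
  exists wn : nat -> 'I_m -> R[i],
    (forall n : nat, (m <= n)%N ->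
       injective (wn n) /\
       (forall z : R[i],
          exceptional_zero alpha m n z <-> exists i : 'I_m, wn n i = z)) /\
    (forall i : 'I_m, wn n i @[n --> \oo] --> (w i : R[i]^o)).
Proof.
have amC : m%:R < alpha%:C%C + 1.
  by rewrite -(rmorph_nat (real_complex R)) -(rmorph1 (real_complex R)) -rmorphD ltcR; lra.
have etaC : toC (eta (alpha + 1) m) = eta (alpha%:C%C + 1) m.
  by rewrite toC_eta rmorphD rmorph1.
have l0 : lead_coef (toC (eta (alpha + 1) m)) != 0.
  by rewrite etaC lead_coef_eq0 laguerre_neq0.
pose W := [seq w i | i <- enum 'I_m].
have wW : toC (eta (alpha + 1) m) =
    lead_coef (toC (eta (alpha + 1) m)) *: \prod_(z <- W) ('X - z%:P).
  by rewrite /W big_map big_enum; exact: w_zeros.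
have rootW z : root (toC (eta (alpha + 1) m)) z = (z \in W).
  by rewrite wW rootZ // root_prod_XsubC.
(* The zeros of eta are simple, because alpha + 1 > m and 0 is not among them. *)
have w_inj : injective w.
  suff uW : uniq W.
    by apply/injectiveP.
  apply: uniq_prod_XsubC => z; rewrite -rootW => ez; have ezC := ez.
  rewrite etaC in ezC; have z0 : z != 0.
    by apply: contraNneq (eta_root_not_ge0 _ _ _ _ amC ezC) => ->.
  have := root_eta_simple _ _ _ _ (negbT (gt_eqF amC)) z0 ezC.
  by rewrite -etaC wW derivZ hornerZ mulf_eq0 negb_or => /andP[].
have /choice[v vP] (n : nat) : exists v : 'I_m -> R[i], (m <= n)%N ->
    injective v /\ forall z, exceptional_zero alpha m n z <-> exists i, v i = z.
  (* For n < m nothing is claimed and 0 is a filler. *)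
  have [mn|] := boolP (m <= n)%N; last by exists (fun=> 0).
  have [x [u [E [_ _ [uE sE] EE _]]]] := XLaguerre_zeros R alpha m n alpha_gt mn.
  exists (fun i => nth 0 E i) => _; split=> [i k /eqP|z].
    by rewrite nth_uniq ?sE // => /eqP/val_inj.
  rewrite EE; split=> [zE|[i <-]]; last by rewrite mem_nth ?sE.
  have iE : (index z E < m)%N by rewrite -sE index_mem.
  by exists (Ordinal iE); rewrite /= nth_index.
have near_w (i : 'I_m) (e : R) : 0 < e ->
    \forall n \near \oo, exists k, `|v n k - w i| < e%:C%C.
  move=> e0; have wi : root (toC (eta (alpha + 1) m)) (w i).
    by rewrite rootW map_f ?mem_enum.
  have [N hN] := exceptional_zero_near R _ _ _ _ alpha_gt wi e0.
  exists (maxn N m) => // n /=; rewrite geq_max => /andP[Nn mn].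
  have [z hz hzw] := hN n Nn mn.
  by have [_ /(_ z)[/(_ hz)[k kz] _]] := vP n mn; exists k; rewrite kz.
have [s [s_inj s_cvg]] := relabel_cvg R m w v w_inj near_w.
exists (fun n i => v n (s n i)); split=> // n mn; have [v_inj vE] := vP n mn.
split=> [i k /v_inj/s_inj //|z]; rewrite vE; split=> [[i <-]|[i <-]]; last by exists (s n i).
(* An injection of a finite set into itself is onto, so relabelling loses no zero. *)
by have [t _ tK] := injF_bij (s_inj n); exists (t i); rewrite tK.
Qed.
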